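(* Let $\theta(x)=\sqrt[x]{2\zeta(x)\Gamma(x+1)}=\bigl(2\zeta(x)\Gamma(x+1)\bigr)^{1/x}$ for real $x>1$. For every integer $k\geq 2$ there exists a real number $X_k$ such that $(-1)^{k}[\log\theta(x)]^{(k)}<0$ for all $x> X_k$.
   Context: Here $\zeta(x)=\sum_{n=1}^{\infty}\frac{1}{n^x}$ (for real $x>1$) is the Riemann zeta function, $\Gamma$ is the Gamma function, and the superscript $(k)$ denotes the $k$th derivative with respect to $x$. *)

(* Defs.v *)
From Stdlib Require Import Reals.
From Coquelicot Require Import Coquelicot.
Open Scope R_scope.

(* Meaningful for x > 1, where the series converges. *)
Definition zeta (x : R) : R :=
  Series (fun n : nat => 1 / Rpower (INR (S n)) x).

(* Euler's integral, improper at both ends; meaningful for x > 0.  The limit at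
   0 is taken from the right, so the junk value of [Rpower] at 0 is harmless. *)
Definition Gamma (x : R) : R :=
  RInt_gen (fun t : R => Rpower t (x - 1) * exp (- t))
    (at_right 0) (Rbar_locally p_infty).

Definition theta (x : R) : R :=
  Rpower (2 * zeta x * Gamma (x + 1)) (1 / x).

Definition log_theta (x : R) : R := ln (theta x).

(* [ex_derive_n f j x] alone only says that [Derive_n f (j - 1)] is
   differentiable at x, so all orders up to k are required. *)
Definition k_times_derivable (f : R -> R) (k : nat) (x : R) : Prop :=
  forall j : nat, (j <= k)%nat -> ex_derive_n f j x.

(* Main.v *)
Require Import Defs.
From Stdlib Require Import Reals Factorial Lra Lia Psatz.
From Coquelicot Require Import Coquelicot.
Open Scope R_scope.

(** Write [log_theta x = F x / x] with
    [F x = ln 2 + ln (zeta x) + ln (Gamma (x + 1))].  The Leibniz formula gives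

      (-1)^k (F / x)^(k) = k! / x^(k+1) * h_k(x),
      h_k(x) = sum_(j <= k) (-x)^j / j! * F^(j)(x),

    where [h_k] is the Taylor polynomial of [F] based at [x] and evaluated at
    [0] ([taylor_at_zero], [is_derive_taylor_quotient]).  Its derivative in the
    base point is the single term [(-x)^k / k! * F^(k+1)(x)]
    ([is_derive_taylor_at_zero]).  It therefore suffices to bound this term above
    by [- c / x] for large [x]: then [h_k] tends to minus infinity like
    [- c ln x] and is eventually negative ([eventually_negative]).  No
    asymptotic expansion is involved; one derivative of order [k + 1 >= 2] of
    [F] has to be estimated, so constants in [F] are irrelevant
    ([log_numerator_chain]).

    For the Gamma part, [ln (Gamma (x + 1))] is, up to a constant, Euler's series
    [sum_(p >= 1) (x ln (1 + 1/p) - ln (1 + x/p))].  Both functions satisfy the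
    functional equation and Wendel's inequality
    [Gamma (a + s) <= a^s Gamma a], and these two properties determine a
    function up to a constant ([wendel_unique_up_to_constant]).  The series can
    be differentiated termwise ([is_derive_Series]); its derivative of order
    [k + 1] has the sign [(-1)^(k+1)] and absolute value at least
    [k! / (x + 1)^(k+1)], the term [p = 1], which yields the [- c / x].

    For the zeta part, every derivative of [zeta] of positive order is
    [O(2^(-x))] and [1 / zeta]
    has bounded derivatives, so every derivative of [ln zeta] of positive order is
    [O(2^(-x))] ([log_zeta_chain]), which is negligible against powers of [x]. *)

(** * The Gamma integral, its functional equation and Wendel's inequality *)

Lemma exp_monotone (x y : R) : x <= y -> exp x <= exp y.
Proof.
  intros [Hlt | ->]; [now apply Rlt_le, exp_increasing | apply Rle_refl].
Qed.

Lemma ln_le_minus_1 (r : R) : 0 < r -> ln r <= r - 1.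
Proof.
  intro Hr; generalize (exp_ineq1_le (ln r)); rewrite exp_ln by assumption; lra.
Qed.

Lemma locally_ball_R (x y : R) (eps : posreal) :
  Rabs (y - x) < eps -> ball x eps y.
Proof. trivial. Qed.

(** For a positive integrand the integrals over [[a, b]] grow in both
    directions, so a uniform bound forces convergence to their supremum. *)
Lemma positive_improper_integral (f : R -> R) (M : R) :
  (forall t, 0 < t -> 0 < f t) ->
  (forall t, 0 < t -> continuous f t) ->
  (forall a b, 0 < a -> a < b -> RInt f a b <= M) ->
  exists l, 0 < l /\ is_RInt_gen f (at_right 0) (Rbar_locally p_infty) l.
Proof.
  intros Hpos Hcont HM.
  assert (Hex : forall a b, 0 < a -> 0 < b -> ex_RInt f a b).
  { intros a b Ha Hb; apply (@ex_RInt_continuous R_CompleteNormedModule).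
    intros z [Hz _]; apply Hcont; revert Hz; unfold Rmin.
    destruct (Rle_dec a b); lra. }
  set (E := fun v => exists a b, 0 < a < b /\ v = RInt f a b).
  destruct (completeness E) as [l [Hub Hleast]].
  - exists M; intros v (a & b & Hab & ->); apply HM; lra.
  - exists (RInt f 1 2), 1, 2; split; [lra | reflexivity].
  - assert (H12 : 0 < RInt f 1 2).
    { apply RInt_gt_0; [lra | intros; apply Hpos; lra | intros; apply Hcont; lra]. }
    assert (Hl : RInt f 1 2 <= l).
    { apply Hub; exists 1, 2; split; [lra | reflexivity]. }
    exists l; split; [lra |].
    intros P [eps HP].
    (* Otherwise [l - eps] would be a smaller upper bound. *)
    assert (Hclose : exists a b, 0 < a < b /\ l - eps < RInt f a b).
    { apply Classical_Prop.NNPP; intro Hno.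
      assert (Hl' : l <= l - eps); [| destruct eps as [e He]; simpl in *; lra].
      apply Hleast; intros v (a & b & Hab & ->).
      apply Rnot_lt_le; intro Hlt; apply Hno; now exists a, b. }
    destruct Hclose as (a0 & b0 & Hab0 & Hl0).
    apply Filter_prod with (fun a => 0 < a < a0) (fun b => b0 < b).
    + assert (Ha0 : 0 < a0) by lra.
      exists (mkposreal a0 Ha0); intros y Hy Hy0.
      unfold ball in Hy; simpl in Hy; unfold AbsRing_ball, abs, minus, plus, opp in Hy.
      simpl in Hy; apply Rabs_def2 in Hy; lra.
    + now exists b0.
    + intros a b Ha Hb; exists (RInt f a b); split.
      * apply (@RInt_correct R_CompleteNormedModule); apply Hex; lra.
      * apply HP; unfold ball; simpl; unfold AbsRing_ball, abs, minus, plus, opp; simpl.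
        assert (Hle : RInt f a b <= l).
        { apply Hub; exists a, b; split; [lra | reflexivity]. }
        assert (H1 : 0 <= RInt f a a0).
        { apply RInt_ge_0; [lra | apply Hex; lra | intros; apply Rlt_le, Hpos; lra]. }
        assert (H2 : 0 <= RInt f b0 b).
        { apply RInt_ge_0; [lra | apply Hex; lra | intros; apply Rlt_le, Hpos; lra]. }
        assert (HC1 := RInt_Chasles f a a0 b (Hex a a0 ltac:(lra) ltac:(lra))
                         (Hex a0 b ltac:(lra) ltac:(lra))).
        assert (HC2 := RInt_Chasles f a0 b0 b (Hex a0 b0 ltac:(lra) ltac:(lra))
                         (Hex b0 b ltac:(lra) ltac:(lra))).
        unfold plus in HC1, HC2; simpl in HC1, HC2.
        apply Rabs_def1; lra.
Qed.

Definition gamma_integrand (y t : R) : R := Rpower t (y - 1) * exp (- t).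

Lemma gamma_integrand_pos (y t : R) : 0 < gamma_integrand y t.
Proof. apply Rmult_lt_0_compat; apply exp_pos. Qed.

Lemma continuous_gamma_integrand (y t : R) :
  0 < t -> continuous (gamma_integrand y) t.
Proof.
  intro Ht; apply (@ex_derive_continuous R_AbsRing R_NormedModule).
  unfold gamma_integrand, Rpower; auto_derive; lra.
Qed.

(** The tangent to [ln] at [2 (y - 1)] has exactly the slope needed to absorb
    the power of [t] into half of the exponential.  The constant is finite
    down to [t = 0] because [y - 1 > 0]. *)
Lemma gamma_integrand_le_exp (y : R) : 1 < y ->
  exists C, 0 < C /\ forall t, 0 < t -> gamma_integrand y t <= C * exp (- (t / 2)).
Proof.
  intro Hy; set (c := 2 * (y - 1)).
  exists (exp ((y - 1) * ln c)); split; [apply exp_pos |]; intros t Ht.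
  unfold gamma_integrand, Rpower; rewrite <- !exp_plus; apply exp_monotone.
  assert (Hc : 0 < c) by (unfold c; lra).
  assert (Hln : ln t <= ln c + (t / c - 1)).
  { assert (Hr : 0 < t / c) by now apply Rdiv_lt_0_compat.
    replace t with (c * (t / c)) at 1 by (field; lra).
    rewrite ln_mult by assumption.
    generalize (ln_le_minus_1 _ Hr); lra. }
  assert (H := Rmult_le_compat_l (y - 1) _ _ ltac:(lra) Hln).
  replace ((y - 1) * (ln c + (t / c - 1)))
    with ((y - 1) * ln c + (t / 2 - (y - 1))) in H by (unfold c; field; lra).
  lra.
Qed.

Lemma gamma_integral_converges (y : R) : 1 < y ->
  exists l, 0 < l /\
    is_RInt_gen (gamma_integrand y) (at_right 0) (Rbar_locally p_infty) l.
Proof.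
  intro Hy; destruct (gamma_integrand_le_exp y Hy) as (C & HC & Hbound).
  apply (positive_improper_integral _ (2 * C)).
  - intros; apply gamma_integrand_pos.
  - apply continuous_gamma_integrand.
  - intros a b Ha Hab.
    assert (Hprim : is_RInt (fun t => C * exp (- (t / 2))) a b
                      (- 2 * C * exp (- (b / 2)) - - 2 * C * exp (- (a / 2)))).
    { apply (is_RInt_derive (fun t => - 2 * C * exp (- (t / 2)))).
      - intros; auto_derive; [trivial | unfold Rdiv; field].
      - intros; apply (@ex_derive_continuous R_AbsRing R_NormedModule).
        auto_derive; trivial. }
    apply Rle_trans with (RInt (fun t => C * exp (- (t / 2))) a b).
    + apply RInt_le; [lra | | eexists; exact Hprim |].
      * apply (@ex_RInt_continuous R_CompleteNormedModule).
        rewrite Rmin_left by lra; intros; apply continuous_gamma_integrand; lra.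
      * intros; apply Hbound; lra.
    + rewrite (is_RInt_unique _ _ _ _ Hprim).
      assert (Hexp : exp (- (a / 2)) < 1) by (rewrite <- exp_0; apply exp_increasing; lra).
      generalize (exp_pos (- (b / 2))); nra.
Qed.

Lemma Gamma_correct (y : R) : 1 < y ->
  0 < Gamma y /\
  is_RInt_gen (gamma_integrand y) (at_right 0) (Rbar_locally p_infty) (Gamma y).
Proof.
  intro Hy; destruct (gamma_integral_converges y Hy) as (l & Hl & Hint).
  replace (Gamma y) with l; [now split |].
  symmetry; unfold Gamma; apply is_RInt_gen_unique; exact Hint.
Qed.

Lemma Gamma_pos (y : R) : 1 < y -> 0 < Gamma y.
Proof. intro Hy; apply (Gamma_correct y Hy). Qed.

Lemma positive_bounds (Q : R -> Prop) : (forall t, 0 < t -> Q t) ->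
  filter_prod (at_right 0) (Rbar_locally p_infty)
    (fun ab => fst ab <= snd ab /\
       forall t, fst ab <= t <= snd ab -> Q t).
Proof.
  intro HQ; apply Filter_prod with (fun a => 0 < a < 1) (fun b => 1 < b).
  - exists (mkposreal 1 Rlt_0_1); intros y Hy Hy0.
    unfold ball in Hy; simpl in Hy; unfold AbsRing_ball, abs, minus, plus, opp in Hy.
    simpl in Hy; apply Rabs_def2 in Hy; lra.
  - now exists 1.
  - intros a b Ha Hb; simpl; split; [lra | intros; apply HQ; lra].
Qed.

Lemma gamma_integrand_vanishes_right (y : R) : 1 < y ->
  filterlim (gamma_integrand y) (Rbar_locally p_infty) (locally 0).
Proof.
  intro Hy; destruct (gamma_integrand_le_exp y Hy) as (C & HC & Hb).
  intros P [eps HP]; exists (2 * C / eps); intros t Ht; apply HP, locally_ball_R.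
  assert (He := cond_pos eps).
  assert (Ht0 : 0 < t).
  { apply Rlt_trans with (2 * C / eps); [apply Rdiv_lt_0_compat; lra | exact Ht]. }
  rewrite Rminus_0_r, Rabs_pos_eq by apply Rlt_le, gamma_integrand_pos.
  apply Rle_lt_trans with (1 := Hb t Ht0).
  apply Rlt_trans with (C * / (t / 2)).
  - apply Rmult_lt_compat_l; [exact HC |].
    rewrite exp_Ropp; apply Rinv_lt_contravar.
    + apply Rmult_lt_0_compat; [lra | apply exp_pos].
    + generalize (exp_ineq1_le (t / 2)); lra.
  - apply Rlt_div_l in Ht; [| exact He].
    apply Rmult_lt_reg_r with t; [exact Ht0 |].
    replace (C * / (t / 2) * t) with (2 * C) by (field; lra); lra.
Qed.

Lemma gamma_integrand_vanishes_left (y : R) : 2 < y ->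
  filterlim (gamma_integrand y) (at_right 0) (locally 0).
Proof.
  intros Hy P [eps HP].
  assert (Hd : 0 < Rmin 1 eps) by (apply Rmin_pos; [lra | apply cond_pos]).
  exists (mkposreal _ Hd); intros t Ht Ht0; apply HP, locally_ball_R.
  change (Rabs (t - 0) < Rmin 1 eps) in Ht.
  rewrite Rminus_0_r, Rabs_pos_eq in Ht by lra.
  rewrite Rminus_0_r, Rabs_pos_eq by apply Rlt_le, gamma_integrand_pos.
  assert (H1 := Rmin_l 1 eps); assert (H2 := Rmin_r 1 eps).
  apply Rle_lt_trans with t; [| lra].
  apply Rle_trans with (exp (ln t)); [| rewrite exp_ln; lra].
  unfold gamma_integrand, Rpower; rewrite <- exp_plus; apply exp_monotone.
  generalize (ln_le_minus_1 t Ht0); intro; nra.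
Qed.

(** Integration by parts: [t^y exp (-t)] vanishes at both ends, so the improper
    integral of its derivative [y t^(y-1) exp (-t) - t^y exp (-t)] is zero. *)
Lemma Gamma_functional_equation (y : R) : 1 < y -> Gamma (y + 1) = y * Gamma y.
Proof.
  intro Hy.
  destruct (Gamma_correct y Hy) as [_ H0].
  destruct (Gamma_correct (y + 1) ltac:(lra)) as [_ H1].
  assert (HD : forall t, 0 < t -> is_derive (gamma_integrand (y + 1)) t
             (y * gamma_integrand y t - gamma_integrand (y + 1) t)).
  { intros t Ht; unfold gamma_integrand, Rpower; auto_derive; [exact Ht |].
    replace ((y + 1 - 1) * ln t) with (ln t + (y - 1) * ln t) by ring.
    rewrite exp_plus, exp_ln by exact Ht; field; lra. }
  assert (HI : is_RInt_gen (Derive (gamma_integrand (y + 1)))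
                 (at_right 0) (Rbar_locally p_infty) (0 - 0)).
  { apply is_RInt_gen_Derive; try typeclasses eauto.
    - eapply filter_imp; [| apply (positive_bounds (ex_derive (gamma_integrand (y + 1))))].
      + intros ab [Hle H]; now rewrite Rmin_left, Rmax_right.
      + intros t Ht; eexists; now apply HD.
    - eapply filter_imp; [| apply (positive_bounds (continuous (Derive (gamma_integrand (y + 1)))))].
      + intros ab [Hle H]; now rewrite Rmin_left, Rmax_right.
      + intros t Ht.
        apply continuous_ext_loc with
          (fun t => minus (scal y (gamma_integrand y t)) (gamma_integrand (y + 1) t)).
        * exists (mkposreal t Ht); intros u Hu; symmetry; apply is_derive_unique, HD.
          change (Rabs (u - t) < t) in Hu; apply Rabs_def2 in Hu; lra.
        * apply (@continuous_minus R_UniformSpace R_AbsRing R_NormedModule).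
          -- apply (@continuous_scal_r R_UniformSpace R_AbsRing R_NormedModule).
             now apply continuous_gamma_integrand.
          -- now apply continuous_gamma_integrand.
    - apply gamma_integrand_vanishes_left; lra.
    - apply gamma_integrand_vanishes_right; lra. }
  assert (HI' : is_RInt_gen (Derive (gamma_integrand (y + 1)))
                 (at_right 0) (Rbar_locally p_infty)
                 (minus (scal y (Gamma y)) (Gamma (y + 1)))).
  { eapply (@is_RInt_gen_ext R_NormedModule);
      [| | | exact (is_RInt_gen_minus _ _ _ _ (is_RInt_gen_scal _ y _ H0) H1)];
      try typeclasses eauto.
    eapply filter_imp; [| apply (positive_bounds (fun t =>
      minus (scal y (gamma_integrand y t)) (gamma_integrand (y + 1) t)
        = Derive (gamma_integrand (y + 1)) t))].
    - intros ab [Hle H] t; rewrite Rmin_left, Rmax_right by exact Hle; intro; apply H; lra.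
    - intros t Ht; symmetry; now apply is_derive_unique, HD. }
  apply (@is_RInt_gen_unique R_CompleteNormedModule) in HI; try typeclasses eauto.
  apply (@is_RInt_gen_unique R_CompleteNormedModule) in HI'; try typeclasses eauto.
  rewrite HI in HI'; unfold minus, plus, opp, scal in HI'; simpl in HI'.
  unfold mult in HI'; simpl in HI'; lra.
Qed.

(** The tangent to [exp] at [s w] lies below [exp] at [0] and at [w]; the
    weighted mean of these two bounds is the claim. *)
Lemma exp_convex_chord (s w : R) : 0 <= s <= 1 ->
  exp (s * w) <= (1 - s) + s * exp w.
Proof.
  intro Hs.
  assert (H0 : exp (s * w) * (1 - s * w) <= 1).
  { replace 1 with (exp (s * w) * exp (- (s * w))) at 2
      by (rewrite <- exp_plus, Rplus_opp_r; apply exp_0).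
    apply Rmult_le_compat_l; [apply Rlt_le, exp_pos |].
    generalize (exp_ineq1_le (- (s * w))); lra. }
  assert (H1 : exp (s * w) * (1 + (1 - s) * w) <= exp w).
  { replace (exp w) with (exp (s * w) * exp ((1 - s) * w))
      by (rewrite <- exp_plus; f_equal; ring).
    apply Rmult_le_compat_l; [apply Rlt_le, exp_pos | apply exp_ineq1_le]. }
  nra.
Qed.

(** Under the integral, [(t / a)^s <= 1 - s + s t / a]; by the functional
    equation the right-hand side integrates to exactly [Gamma a].  This single
    inequality replaces log-convexity: it bounds increments of [ln Gamma] from
    above and, applied at [a + s] with step [1 - s], also from below. *)
Lemma Gamma_Wendel (a s : R) : 1 < a -> 0 <= s <= 1 ->
  Gamma (a + s) <= Rpower a s * Gamma a.
Proof.
  intros Ha Hs.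
  destruct (Gamma_correct (a + s) ltac:(lra)) as [Hp H].
  destruct (Gamma_correct a Ha) as [_ H0].
  destruct (Gamma_correct (a + 1) ltac:(lra)) as [_ H1].
  assert (Hpt : forall t, 0 < t ->
    norm (gamma_integrand (a + s) t) <=
    plus (scal (Rpower a s * (1 - s)) (gamma_integrand a t))
         (scal (Rpower a s * (s / a)) (gamma_integrand (a + 1) t))).
  { intros t Ht; change (norm (gamma_integrand (a + s) t))
      with (Rabs (gamma_integrand (a + s) t)).
    rewrite Rabs_pos_eq by apply Rlt_le, gamma_integrand_pos.
    unfold plus, scal; simpl; unfold mult; simpl.
    assert (Hr : exp (s * ln (t / a)) <= (1 - s) + s * (t / a)).
    { rewrite <- (exp_ln (t / a)) at 2 by (apply Rdiv_lt_0_compat; lra).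
      now apply exp_convex_chord. }
    assert (Hlt : ln t = ln a + ln (t / a)).
    { rewrite <- ln_mult by (try apply Rdiv_lt_0_compat; lra).
      f_equal; field; lra. }
    replace (gamma_integrand (a + s) t)
      with (Rpower a s * gamma_integrand a t * exp (s * ln (t / a))).
    2: { unfold gamma_integrand, Rpower; rewrite <- !exp_plus, Hlt; f_equal; ring. }
    replace (gamma_integrand (a + 1) t) with (t * gamma_integrand a t).
    2: { unfold gamma_integrand, Rpower.
         replace ((a + 1 - 1) * ln t) with (ln t + (a - 1) * ln t) by ring.
         rewrite exp_plus, exp_ln by exact Ht; ring. }
    replace (_ + _) with (Rpower a s * gamma_integrand a t * ((1 - s) + s * (t / a)))
      by (field; lra).
    apply Rmult_le_compat_l; [| exact Hr].
    apply Rmult_le_pos; [apply Rlt_le, exp_pos | apply Rlt_le, gamma_integrand_pos]. }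
  assert (Hcmp := is_RInt_gen_plus _ _ _ _
    (is_RInt_gen_scal _ (Rpower a s * (1 - s)) _ H0)
    (is_RInt_gen_scal _ (Rpower a s * (s / a)) _ H1)).
  assert (Hle := RInt_gen_norm _ _ _ _
    (filter_imp _ _ (fun ab H => proj1 H) (positive_bounds (fun _ => True) (fun _ _ => I)))
    (filter_imp _ _ (fun ab H => proj2 H) (positive_bounds _ Hpt)) H Hcmp).
  change (norm (Gamma (a + s))) with (Rabs (Gamma (a + s))) in Hle.
  rewrite Rabs_pos_eq in Hle by lra; apply Rle_trans with (1 := Hle).
  unfold plus, scal; simpl; unfold mult; simpl.
  rewrite Gamma_functional_equation by exact Ha.
  apply Req_le; field; lra.
Qed.

(** * Series and termwise differentiation *)

Lemma is_derive_of_quadratic_error (F : R -> R) (a x l K : R) :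
  a < x ->
  (forall y, a < y -> Rabs (F y - F x - l * (y - x)) <= K * (y - x) ^ 2) ->
  is_derive F x l.
Proof.
  intros Hax HK; apply is_derive_Reals; intros eps Heps.
  assert (HK1 : 0 < Rabs K + 1) by (generalize (Rabs_pos K); lra).
  assert (Hd : 0 < Rmin (x - a) (eps / (Rabs K + 1))).
  { apply Rmin_pos; [lra | now apply Rdiv_lt_0_compat]. }
  exists (mkposreal _ Hd); intros h Hh0 Hh; simpl in Hh.
  assert (Hh1 := Rlt_le_trans _ _ _ Hh (Rmin_l _ _)).
  assert (Hh2 := Rlt_le_trans _ _ _ Hh (Rmin_r _ _)).
  apply Rlt_div_r in Hh2; [| exact HK1].
  assert (Hpos := Rabs_pos_lt h Hh0).
  assert (Hay : a < x + h) by (apply Rabs_def2 in Hh1; lra).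
  specialize (HK _ Hay); replace (x + h - x) with h in HK by ring.
  replace ((F (x + h) - F x) / h - l) with ((F (x + h) - F x - l * h) / h)
    by (field; exact Hh0).
  unfold Rdiv; rewrite Rabs_mult, Rabs_inv.
  apply Rmult_lt_reg_r with (Rabs h); [exact Hpos |].
  rewrite Rmult_assoc, Rinv_l, Rmult_1_r by lra.
  apply Rle_lt_trans with (1 := HK); rewrite <- (pow2_abs h).
  assert (HKa := Rle_abs K); nra.
Qed.

Lemma Series_le_of_ex (u v : nat -> R) :
  (forall n, u n <= v n) -> ex_series u -> ex_series v -> Series u <= Series v.
Proof.
  intros Huv Hu Hv.
  apply (is_lim_seq_le (sum_n u) (sum_n v) (Series u) (Series v)).
  - intro n; unfold sum_n; now apply sum_n_m_le.
  - exact (Series_correct u Hu).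
  - exact (Series_correct v Hv).
Qed.

Lemma ex_series_dominated (u M : nat -> R) :
  (forall n, Rabs (u n) <= M n) -> ex_series M -> ex_series u.
Proof. intros Hu; now apply (@ex_series_le R_AbsRing R_CompleteNormedModule). Qed.

Lemma Rabs_Series_le (u M : nat -> R) :
  (forall n, Rabs (u n) <= M n) -> ex_series M -> Rabs (Series u) <= Series M.
Proof.
  intros Hu HM.
  assert (Ha : ex_series (fun n => Rabs (u n))).
  { apply ex_series_dominated with M; [| exact HM].
    intro n; now rewrite Rabs_Rabsolu. }
  apply Rle_trans with (1 := Series_Rabs u Ha); now apply Series_le_of_ex.
Qed.

Lemma Series_ge_first (u : nat -> R) :
  (forall n, 0 <= u n) -> ex_series u -> u 0%nat <= Series u.
Proof.
  intros Hu Hex; rewrite Series_incr_1 by exact Hex.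
  enough (0 <= Series (fun n => u (S n))) by lra.
  replace 0 with (0 * Series (fun n => u (S n))) by ring.
  rewrite <- Series_scal_l; apply Series_le.
  - intro n; generalize (Hu (S n)); lra.
  - now apply (ex_series_incr_1 u).
Qed.

Lemma is_derive_continuity_pt (f : R -> R) (x l : R) :
  is_derive f x l -> continuity_pt f x.
Proof.
  intro H; apply continuity_pt_filterlim.
  apply (@ex_derive_continuous R_AbsRing R_NormedModule); now exists l.
Qed.

Lemma taylor_first_order (f g h : R -> R) (a x y M : R) :
  (forall t, a < t -> is_derive f t (g t)) ->
  (forall t, a < t -> is_derive g t (h t)) ->
  (forall t, a < t -> Rabs (h t) <= M) ->
  a < x -> a < y ->
  Rabs (f y - f x - g x * (y - x)) <= M * (y - x) ^ 2.
Proof.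
  intros Hf Hg Hh Hx Hy.
  assert (Hlow : a < Rmin x y) by now apply Rmin_glb_lt.
  destruct (MVT_gen f x y g) as (c & Hc & Ef).
  { intros t Ht; apply Hf; lra. }
  { intros t Ht; eapply is_derive_continuity_pt, Hf; lra. }
  assert (Hac : a < c) by lra.
  assert (Hlow' : a < Rmin x c) by now apply Rmin_glb_lt.
  destruct (MVT_gen g x c h) as (d & Hd & Eg).
  { intros t Ht; apply Hg; lra. }
  { intros t Ht; eapply is_derive_continuity_pt, Hg; lra. }
  replace (f y - f x - g x * (y - x)) with (h d * ((c - x) * (y - x))).
  2: { rewrite Ef; replace (g c) with (g x + h d * (c - x)) by lra; ring. }
  rewrite Rabs_mult.
  assert (Hcxy : Rabs ((c - x) * (y - x)) <= (y - x) ^ 2).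
  { destruct (Rle_dec x y).
    - rewrite Rmin_left, Rmax_right in Hc by lra; rewrite Rabs_pos_eq; nra.
    - rewrite Rmin_right, Rmax_left in Hc by lra; rewrite Rabs_pos_eq; nra. }
  apply Rmult_le_compat; try apply Rabs_pos; [apply Hh; lra | exact Hcxy].
Qed.

(** A summable bound on the second derivatives makes the first-order Taylor
    errors of the terms add up to [O((y - x)^2)], which gives the derivative of
    the sum without any appeal to uniform convergence. *)
Lemma is_derive_Series (f g h : nat -> R -> R) (M : nat -> R) (a x : R) :
  (forall n t, a < t -> is_derive (f n) t (g n t)) ->
  (forall n t, a < t -> is_derive (g n) t (h n t)) ->
  (forall n t, a < t -> Rabs (h n t) <= M n) ->
  ex_series M ->
  (forall t, a < t -> ex_series (fun n => f n t)) ->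
  (forall t, a < t -> ex_series (fun n => g n t)) ->
  a < x ->
  is_derive (fun t => Series (fun n => f n t)) x (Series (fun n => g n x)).
Proof.
  intros Hf Hg Hh HM Ef Eg Hx.
  apply is_derive_of_quadratic_error with (a := a) (K := Series M); [exact Hx |].
  intros y Hy.
  rewrite <- Series_minus by now apply Ef.
  rewrite <- Series_scal_r, <- Series_minus, <- Series_scal_r.
  - apply Rabs_Series_le.
    + intro n; now apply taylor_first_order with (h := h n) (a := a);
        [apply Hf | apply Hg | apply Hh | |].
    + now apply ex_series_scal_r.
  - apply (@ex_series_minus R_AbsRing R_NormedModule); now apply Ef.
  - now apply ex_series_scal_r, Eg.
Qed.

Lemma is_series_of_lim (u : nat -> R) (l : R) :
  is_lim_seq (sum_n u) l -> is_series u l.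
Proof. trivial. Qed.

Lemma is_lim_seq_inv_shift : is_lim_seq (fun n => / (INR n + 2)) 0.
Proof.
  apply (is_lim_seq_ext (fun n => / INR (n + 2))).
  - intro n; now rewrite plus_INR.
  - apply (is_lim_seq_incr_n (fun n => / INR n) 2).
    replace (Finite 0) with (Rbar_inv p_infty) by reflexivity.
    apply is_lim_seq_inv; [apply is_lim_seq_INR | discriminate].
Qed.

Lemma ex_series_inverse_squares : ex_series (fun n => / (INR n + 1) ^ 2).
Proof.
  apply ex_series_dominated with
    (fun n => 2 * (/ (INR n + 1) - / (INR n + 2))).
  - intro n; assert (Hn := pos_INR n).
    rewrite Rabs_pos_eq by (apply Rlt_le, Rinv_0_lt_compat; nra).
    replace (2 * _) with (/ ((INR n + 1) * (INR n + 2) / 2)) by (field; lra).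
    apply Rinv_le_contravar; nra.
  - exists 2; apply is_series_of_lim, (is_lim_seq_ext (fun N => 2 - 2 * / (INR N + 2))).
    + induction n as [| n IH].
      * rewrite sum_O; simpl; field.
      * rewrite sum_Sn, <- IH; unfold plus; simpl plus; rewrite S_INR.
        assert (Hn := pos_INR n); unfold AbelianMonoid.plus; simpl; field; lra.
    + replace (Finite 2) with (Finite (2 - 2 * 0)) by (f_equal; ring).
      apply is_lim_seq_minus'; [apply is_lim_seq_const |].
      apply (is_lim_seq_scal_l _ 2 0), is_lim_seq_inv_shift.
Qed.

(** * The series for log Gamma *)

Lemma ln_diff_le (u v : R) : 0 < u -> 0 < v -> ln u - ln v <= (u - v) / v.
Proof.
  intros Hu Hv; assert (Hr : 0 < u / v) by now apply Rdiv_lt_0_compat.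
  replace (ln u) with (ln (u / v) + ln v).
  - generalize (ln_le_minus_1 _ Hr); replace ((u - v) / v) with (u / v - 1);
      [lra | field; lra].
  - rewrite <- ln_mult by assumption; f_equal; field; lra.
Qed.

(** With [p = n + 1], the [j]th derivative of Euler's summand
    [x ln (1 + 1/p) - ln (1 + x/p)], whose sum over [n] is [ln (Gamma (x + 1))]. *)
Definition log_gamma_term (j n : nat) (x : R) : R :=
  match j with
  | 0%nat => x * (ln (INR n + 2) - ln (INR n + 1))
             - (ln (x + (INR n + 1)) - ln (INR n + 1))
  | 1%nat => (ln (INR n + 2) - ln (INR n + 1)) - / (x + (INR n + 1))
  | S (S i) => (-1) ^ i * (INR (fact (S i)) / (x + (INR n + 1)) ^ (S (S i)))
  end.

Definition log_gamma_series (j : nat) (x : R) : R :=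
  Series (fun n => log_gamma_term j n x).

Lemma is_derive_inv_pow (p : R) (m : nat) (x : R) : x + p <> 0 ->
  is_derive (fun t => / (t + p) ^ m) x (- INR m * / (x + p) ^ S m).
Proof.
  intro Hp; assert (Hq := pow_nonzero _ m Hp).
  auto_derive; [exact Hq |].
  destruct m as [| m]; [simpl; field; exact Hp |].
  change (pred (S m)) with m; simpl pow; assert (Hq' := pow_nonzero _ m Hp).
  field; now split.
Qed.

Lemma is_derive_log_gamma_term (j n : nat) (x : R) : 0 < x ->
  is_derive (log_gamma_term j n) x (log_gamma_term (S j) n x).
Proof.
  intro Hx; assert (Hn := pos_INR n).
  destruct j as [| [| i]]; unfold log_gamma_term.
  - auto_derive; [lra | field; lra].
  - auto_derive; [lra | simpl; field; lra].
  - assert (Hp : x + (INR n + 1) <> 0) by lra.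
    apply is_derive_ext with
      (fun t => ((-1) ^ i * INR (fact (S i))) * / (t + (INR n + 1)) ^ S (S i)).
    { intro t; unfold Rdiv; now rewrite Rmult_assoc. }
    replace ((-1) ^ S i * _) with (((-1) ^ i * INR (fact (S i)))
               * (- INR (S (S i)) * / (x + (INR n + 1)) ^ S (S (S i)))).
    + apply is_derive_scal, is_derive_inv_pow, Hp.
    + replace (INR (fact (S (S i)))) with (INR (S (S i)) * INR (fact (S i)))
        by (rewrite <- mult_INR; reflexivity).
      replace ((-1) ^ S i) with (- (-1) ^ i) by (simpl; ring).
      unfold Rdiv; ring.
Qed.

(** From the second derivative on, the bound does not depend on [x]; this is
    what termwise differentiation at every order [j >= 0] consumes. *)
Lemma log_gamma_term_uniform_bound (i n : nat) (x : R) : 0 < x ->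
  Rabs (log_gamma_term (S (S i)) n x) <= INR (fact (S i)) * / (INR n + 1) ^ 2.
Proof.
  intro Hx; assert (Hn := pos_INR n).
  unfold log_gamma_term; set (p := INR n + 1).
  assert (Hp : 1 <= p) by (unfold p; lra).
  rewrite Rabs_mult, pow_1_abs, Rmult_1_l.
  assert (Hf := INR_fact_lt_0 (S i)).
  assert (Hpow : p ^ 2 <= (x + p) ^ S (S i)).
  { apply Rle_trans with (p ^ S (S i)).
    - apply Rle_pow; [exact Hp | lia].
    - apply pow_incr; lra. }
  rewrite Rabs_pos_eq.
  - apply Rmult_le_compat_l; [lra | apply Rinv_le_contravar; [nra | exact Hpow]].
  - apply Rlt_le, Rdiv_lt_0_compat; [exact Hf | nra].
Qed.

Lemma log_gamma_term_bound (j : nat) (x : R) : 0 < x ->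
  exists C, forall n, Rabs (log_gamma_term j n x) <= C * / (INR n + 1) ^ 2.
Proof.
  intro Hx.
  assert (Hfrac : forall p c, 1 <= p -> 0 <= c -> c / (p * (x + p)) <= c * / p ^ 2).
  { intros p c Hp Hc; unfold Rdiv; apply Rmult_le_compat_l; [exact Hc |].
    apply Rinv_le_contravar; nra. }
  assert (Hfrac' : forall p c, 1 <= p -> 0 <= c -> c / (p * (p + 1)) <= c * / p ^ 2).
  { intros p c Hp Hc; unfold Rdiv; apply Rmult_le_compat_l; [exact Hc |].
    apply Rinv_le_contravar; nra. }
  assert (Hln : forall n, let p := INR n + 1 in
    1 <= p /\ / (p + 1) <= ln (INR n + 2) - ln p <= / p /\
    x / (x + p) <= ln (x + p) - ln p <= x / p).
  { intro n; assert (Hn := pos_INR n); simpl.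
    replace (INR n + 1 + 1) with (INR n + 2) by ring.
    assert (H1 := ln_diff_le (INR n + 2) (INR n + 1) ltac:(lra) ltac:(lra)).
    assert (H2 := ln_diff_le (INR n + 1) (INR n + 2) ltac:(lra) ltac:(lra)).
    assert (H3 := ln_diff_le (x + (INR n + 1)) (INR n + 1) ltac:(lra) ltac:(lra)).
    assert (H4 := ln_diff_le (INR n + 1) (x + (INR n + 1)) ltac:(lra) ltac:(lra)).
    replace ((INR n + 2 - (INR n + 1)) / (INR n + 1)) with (/ (INR n + 1)) in H1
      by (field; lra).
    replace ((INR n + 1 - (INR n + 2)) / (INR n + 2)) with (- / (INR n + 2)) in H2
      by (field; lra).
    replace ((x + (INR n + 1) - (INR n + 1)) / (INR n + 1)) with (x / (INR n + 1)) in H3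
      by (field; lra).
    replace ((INR n + 1 - (x + (INR n + 1))) / (x + (INR n + 1)))
      with (- (x / (x + (INR n + 1)))) in H4 by (field; lra).
    repeat split; lra. }
  destruct j as [| [| i]].
  - exists (x + x ^ 2); intro n; destruct (Hln n) as (Hp & [A1 A2] & B1 & B2).
    unfold log_gamma_term; set (p := INR n + 1) in *.
    assert (X1 := Rmult_le_compat_l x _ _ ltac:(lra) A1).
    assert (X2 := Rmult_le_compat_l x _ _ ltac:(lra) A2).
    assert (Y1 := Hfrac p (x ^ 2) Hp ltac:(nra)).
    assert (Y2 := Hfrac' p x Hp ltac:(lra)).
    replace (x ^ 2 / (p * (x + p))) with (x * / p - x / (x + p)) in Y1 by (field; lra).
    replace (x / (p * (p + 1))) with (x / p - x * / (p + 1)) in Y2 by (field; lra).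
    assert (Hp2 : 0 < / p ^ 2) by (apply Rinv_0_lt_compat; nra).
    apply Rabs_le; nra.
  - exists (x + 1); intro n; destruct (Hln n) as (Hp & [A1 A2] & _).
    unfold log_gamma_term; set (p := INR n + 1) in *.
    assert (Y1 := Hfrac p x Hp ltac:(lra)).
    assert (Y2 := Hfrac' p 1 Hp ltac:(lra)).
    replace (x / (p * (x + p))) with (/ p - / (x + p)) in Y1 by (field; lra).
    replace (1 / (p * (p + 1))) with (/ p - / (p + 1)) in Y2 by (field; lra).
    assert (Hp2 : 0 < / p ^ 2) by (apply Rinv_0_lt_compat; nra).
    assert (Hle : / (x + p) <= / p) by (apply Rinv_le_contravar; lra).
    apply Rabs_le; nra.
  - exists (INR (fact (S i))); intro n; now apply log_gamma_term_uniform_bound.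
Qed.

Lemma ex_log_gamma_series (j : nat) (x : R) : 0 < x ->
  ex_series (fun n => log_gamma_term j n x).
Proof.
  intro Hx; destruct (log_gamma_term_bound j x Hx) as [C HC].
  apply (ex_series_dominated _ _ HC).
  apply (@ex_series_scal_l R_AbsRing R_NormedModule), ex_series_inverse_squares.
Qed.

Lemma is_derive_log_gamma_series (j : nat) (x : R) : 0 < x ->
  is_derive (log_gamma_series j) x (log_gamma_series (S j) x).
Proof.
  intro Hx; unfold log_gamma_series.
  apply (is_derive_Series (log_gamma_term j) (log_gamma_term (S j))
           (log_gamma_term (S (S j)))
           (fun n => INR (fact (S j)) * / (INR n + 1) ^ 2) 0); trivial;
    intros; try now apply is_derive_log_gamma_term.
  - now apply log_gamma_term_uniform_bound.
  - apply (@ex_series_scal_l R_AbsRing R_NormedModule), ex_series_inverse_squares.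
  - now apply ex_log_gamma_series.
  - now apply ex_log_gamma_series.
Qed.

(** All terms of the series have the sign [(-1)^i], so the first one is a lower
    bound.  It is smaller than the sum by a factor of order [x], but it still
    leads to a non-integrable [1 / x] at the end. *)
Lemma log_gamma_series_derivative_lower_bound (i : nat) (x : R) : 0 < x ->
  INR (fact (S i)) / (x + 1) ^ S (S i) <= (-1) ^ i * log_gamma_series (S (S i)) x.
Proof.
  intro Hx; unfold log_gamma_series; rewrite <- Series_scal_l.
  assert (E : forall n, (-1) ^ i * log_gamma_term (S (S i)) n x
              = INR (fact (S i)) / (x + (INR n + 1)) ^ S (S i)).
  { intro n; unfold log_gamma_term; rewrite <- Rmult_assoc, <- Rpow_mult_distr.
    replace (-1 * -1) with 1 by ring; rewrite pow1; ring. }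
  replace (INR (fact (S i)) / (x + 1) ^ S (S i))
    with ((-1) ^ i * log_gamma_term (S (S i)) 0 x).
  2: { rewrite E; simpl INR; now rewrite Rplus_0_l. }
  apply (Series_ge_first (fun n => (-1) ^ i * log_gamma_term (S (S i)) n x)).
  - intro n; rewrite E; assert (Hn := pos_INR n).
    apply Rlt_le, Rdiv_lt_0_compat; [apply INR_fact_lt_0 | apply pow_lt; lra].
  - apply (@ex_series_scal_l R_AbsRing R_NormedModule).
    now apply ex_log_gamma_series.
Qed.

(** The functional equation and Wendel's inequality, in logarithmic form and
    for the shifted function [ln (Gamma (x + 1))].  They play the part of the
    Bohr-Mollerup axioms. *)
Definition wendel (F : R -> R) : Prop :=
  (forall x, 0 < x -> F (x + 1) = F x + ln (x + 1)) /\
  (forall a s, 0 < a -> 0 <= s <= 1 -> F (a + s) <= F a + s * ln (a + 1)).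

Lemma wendel_log_Gamma : wendel (fun x => ln (Gamma (x + 1))).
Proof.
  split.
  - intros x Hx; rewrite (Gamma_functional_equation (x + 1)) by lra.
    rewrite ln_mult; [ring | lra | apply Gamma_pos; lra].
  - intros a s Ha Hs; rewrite <- (ln_Rpower (a + 1) s).
    rewrite <- ln_mult; [| apply Gamma_pos; lra | apply exp_pos].
    apply ln_le; [apply Gamma_pos; lra |]; rewrite Rmult_comm.
    replace (a + s + 1) with (a + 1 + s) by ring; apply Gamma_Wendel; lra.
Qed.

(** The increments of the terms telescope. *)
Lemma log_gamma_series_functional_equation (x : R) : 0 < x ->
  log_gamma_series 0 (x + 1) = log_gamma_series 0 x + ln (x + 1).
Proof.
  intro Hx; enough (log_gamma_series 0 (x + 1) - log_gamma_series 0 x = ln (x + 1)) by lra.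
  unfold log_gamma_series; rewrite <- Series_minus by (apply ex_log_gamma_series; lra).
  apply is_series_unique, is_series_of_lim.
  apply (is_lim_seq_ext (fun N => ln (x + 1) - (ln (x + 1 + (INR N + 1)) - ln (INR N + 2)))).
  - induction n as [| n IH].
    + rewrite sum_O; unfold log_gamma_term; simpl INR.
      replace (0 + 1) with 1 by ring; rewrite ln_1; ring.
    + rewrite sum_Sn, <- IH; unfold log_gamma_term.
      rewrite !S_INR.
      replace (x + 1 + (INR n + 1)) with (x + (INR n + 1 + 1)) by ring.
      replace (INR n + 1 + 1) with (INR n + 2) by ring.
      unfold plus; simpl; ring.
  - apply (is_lim_seq_le_le (fun N => ln (x + 1) - x * / (INR N + 2)) _ (fun _ => ln (x + 1))).
    + intro N; assert (HN := pos_INR N).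
      assert (H1 := ln_diff_le (x + 1 + (INR N + 1)) (INR N + 2) ltac:(lra) ltac:(lra)).
      replace ((x + 1 + (INR N + 1) - (INR N + 2)) / (INR N + 2)) with (x * / (INR N + 2))
        in H1 by (field; lra).
      assert (H2 := ln_le (INR N + 2) (x + 1 + (INR N + 1)) ltac:(lra) ltac:(lra)); lra.
    + replace (Finite (ln (x + 1))) with (Finite (ln (x + 1) - x * 0)) by (f_equal; ring).
      apply is_lim_seq_minus'; [apply is_lim_seq_const |].
      apply (is_lim_seq_scal_l _ x 0), is_lim_seq_inv_shift.
    + apply is_lim_seq_const.
Qed.

Lemma ln_concave (u v s : R) : 0 < u -> 0 < v -> 0 <= s <= 1 ->
  (1 - s) * ln u + s * ln v <= ln ((1 - s) * u + s * v).
Proof.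
  intros Hu Hv Hs; set (c := (1 - s) * u + s * v).
  assert (Hc : 0 < c) by (unfold c; destruct (Req_dec s 0); [subst; lra | nra]).
  assert (H1 := ln_diff_le u c Hu Hc); assert (H2 := ln_diff_le v c Hv Hc).
  assert (E : (1 - s) * ((u - c) / c) + s * ((v - c) / c) = 0).
  { replace ((1 - s) * ((u - c) / c) + s * ((v - c) / c))
      with (((1 - s) * u + s * v - c) / c) by (field; lra).
    fold c; unfold Rdiv; ring. }
  assert (H3 := Rmult_le_compat_l (1 - s) _ _ ltac:(lra) H1).
  assert (H4 := Rmult_le_compat_l s _ _ ltac:(lra) H2); lra.
Qed.

(** Each term is convex in [x], hence so is the sum, and a convex function that
    satisfies the functional equation obeys the chord bound. *)
Lemma wendel_log_gamma_series : wendel (log_gamma_series 0).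
Proof.
  split; [exact log_gamma_series_functional_equation |].
  intros a s Ha Hs.
  apply Rle_trans with ((1 - s) * log_gamma_series 0 a + s * log_gamma_series 0 (a + 1)).
  2: { rewrite log_gamma_series_functional_equation by exact Ha; lra. }
  assert (E0 := ex_log_gamma_series 0 a Ha).
  assert (E1 := ex_log_gamma_series 0 (a + 1) ltac:(lra)).
  assert (F0 := ex_series_scal_l (1 - s) _ E0).
  assert (F1 := ex_series_scal_l s _ E1).
  unfold log_gamma_series; rewrite <- !Series_scal_l, <- Series_plus by assumption.
  apply Series_le_of_ex.
  - intro n; assert (Hn := pos_INR n); unfold log_gamma_term.
    assert (H := ln_concave (a + (INR n + 1)) (a + 1 + (INR n + 1)) s
                  ltac:(lra) ltac:(lra) Hs).
    replace ((1 - s) * (a + (INR n + 1)) + s * (a + 1 + (INR n + 1)))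
      with (a + s + (INR n + 1)) in H by ring; lra.
  - apply ex_log_gamma_series; lra.
  - now apply (@ex_series_plus R_AbsRing R_NormedModule).
Qed.

(** The lower bound is the chord inequality from [a + s] to [a + 1], compared
    with the functional equation. *)
Lemma wendel_increment (F : R -> R) (a s : R) : wendel F -> 0 < a -> 0 <= s <= 1 ->
  s * ln (a + 1) - / (a + 1) <= F (a + s) - F a <= s * ln (a + 1).
Proof.
  intros [Hfe Hch] Ha Hs; split; [| generalize (Hch a s Ha Hs); lra].
  assert (H := Hch (a + s) (1 - s) ltac:(lra) ltac:(lra)).
  replace (a + s + (1 - s)) with (a + 1) in H by ring; rewrite Hfe in H by exact Ha.
  assert (Hl := ln_diff_le (a + s + 1) (a + 1) ltac:(lra) ltac:(lra)).
  replace ((a + s + 1 - (a + 1)) / (a + 1)) with (s * / (a + 1)) in Hl by (field; lra).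
  assert (Hi : 0 < / (a + 1)) by (apply Rinv_0_lt_compat; lra).
  assert (Hm := Rmult_le_compat_l (1 - s) _ _ ltac:(lra) Hl).
  assert ((1 - s) * (s * / (a + 1)) <= / (a + 1)) by nra; lra.
Qed.

(** The difference [F - G] has period [1], and its increments over a step
    [s <= 1] starting at [a] are at most [1 / (a + 1)].  Pushing [a] to infinity
    along the period shows that these increments vanish. *)
Lemma wendel_unique_up_to_constant (F G : R -> R) : wendel F -> wendel G ->
  forall x, 1 <= x -> F x - G x = F 1 - G 1.
Proof.
  intros HF HG.
  assert (Hper : forall n a, 0 < a -> F (a + INR n) - G (a + INR n) = F a - G a).
  { induction n as [| n IH]; intros a Ha; [simpl; now rewrite Rplus_0_r |].
    rewrite S_INR; replace (a + (INR n + 1)) with (a + INR n + 1) by ring.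
    assert (Hn := pos_INR n).
    rewrite (proj1 HF), (proj1 HG), <- (IH a Ha) by lra; ring. }
  assert (Hstep : forall s, 0 <= s <= 1 -> F (1 + s) - G (1 + s) = F 1 - G 1).
  { intros s Hs; apply cond_eq; intros eps Heps.
    (* Both increments are compared after a shift by [n], beyond [1 / eps]. *)
    destruct (nfloor_ex (/ eps)) as [n Hn]; [apply Rlt_le, Rinv_0_lt_compat, Heps |].
    assert (Hn0 := pos_INR n).
    rewrite <- (Hper n 1), <- (Hper n (1 + s)) by lra.
    replace (1 + s + INR n) with (1 + INR n + s) by ring.
    assert (IF := wendel_increment F (1 + INR n) s HF ltac:(lra) Hs).
    assert (IG := wendel_increment G (1 + INR n) s HG ltac:(lra) Hs).
    assert (Hinv : / (1 + INR n + 1) < eps).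
    { rewrite <- (Rinv_inv eps); apply Rinv_lt_contravar; [| lra].
      apply Rmult_lt_0_compat; [now apply Rinv_0_lt_compat | lra]. }
    apply Rabs_def1; lra. }
  intros x Hx; destruct (nfloor_ex (x - 1)) as [n Hn]; [lra |].
  replace x with (1 + (x - 1 - INR n) + INR n) by ring.
  rewrite Hper by lra; apply Hstep; lra.
Qed.

Lemma log_Gamma_series_representation :
  exists c, forall x, 1 <= x -> ln (Gamma (x + 1)) = log_gamma_series 0 x + c.
Proof.
  exists (ln (Gamma (1 + 1)) - log_gamma_series 0 1); intros x Hx.
  generalize (wendel_unique_up_to_constant _ _ wendel_log_Gamma
                wendel_log_gamma_series x Hx); simpl; lra.
Qed.

(** * The zeta series and the decay of its derivatives *)

Lemma exp_INR_mult (n : nat) (u : R) : exp (INR n * u) = exp u ^ n.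
Proof.
  induction n as [| n IH]; [simpl; now rewrite Rmult_0_l, exp_0 |].
  rewrite S_INR, Rmult_plus_distr_r, Rmult_1_l, exp_plus, IH; simpl; ring.
Qed.

(** From [u <= exp u] at [u = y / (j + 1)], raised to the power [j]. *)
Lemma pow_le_exp (j : nat) (y : R) : 0 <= y -> y ^ j <= (INR j + 1) ^ j * exp y.
Proof.
  intro Hy; assert (Hj := pos_INR j).
  set (u := y / (INR j + 1)).
  assert (Eu : y = (INR j + 1) * u) by (unfold u; field; lra).
  assert (Hu : 0 <= u) by (apply Rdiv_le_0_compat; lra).
  rewrite Eu at 1; rewrite Rpow_mult_distr.
  apply Rmult_le_compat_l; [apply pow_le; lra |].
  apply Rle_trans with (exp u ^ j).
  - apply pow_incr; generalize (exp_ineq1_le u); lra.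
  - rewrite <- exp_INR_mult; apply exp_monotone; rewrite Eu; nra.
Qed.

(** The [j]th derivative in [x] of [(n + 1)^(-x)]. *)
Definition zeta_term (j n : nat) (x : R) : R :=
  (- ln (INR n + 1)) ^ j * Rpower (INR n + 1) (- x).

Definition zeta_series (j : nat) (x : R) : R := Series (fun n => zeta_term j n x).

Lemma zeta_series_0 (x : R) : zeta_series 0 x = zeta x.
Proof.
  unfold zeta_series, zeta; apply Series_ext; intro n; unfold zeta_term.
  rewrite S_INR, Rpower_Ropp; simpl; unfold Rdiv; ring.
Qed.

Lemma is_derive_zeta_term (j n : nat) (x : R) :
  is_derive (zeta_term j n) x (zeta_term (S j) n x).
Proof. unfold zeta_term, Rpower; auto_derive; [trivial | simpl; ring]. Qed.

Lemma ln_INR_succ_nonneg (n : nat) : 0 <= ln (INR n + 1).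
Proof. rewrite <- ln_1; apply ln_le; generalize (pos_INR n); lra. Qed.

(** The powers of the logarithm cost one factor [n + 1]; splitting off
    [(n + 1)^(-2)] for summability leaves [(n + 1)^(3 - x)]. *)
Lemma zeta_term_bound (j n : nat) (x : R) :
  Rabs (zeta_term j n x)
    <= (INR j + 1) ^ j * (/ (INR n + 1) ^ 2 * exp ((3 - x) * ln (INR n + 1))).
Proof.
  assert (Hn := pos_INR n); unfold zeta_term.
  assert (Hl := ln_INR_succ_nonneg n).
  rewrite Rabs_mult, <- RPow_abs, Rabs_Ropp, Rabs_pos_eq by exact Hl.
  rewrite (Rabs_pos_eq (Rpower _ _)) by apply Rlt_le, exp_pos.
  replace (/ (INR n + 1) ^ 2) with (exp (- 2 * ln (INR n + 1))).
  2: { replace (- 2 * ln (INR n + 1)) with (- (INR 2 * ln (INR n + 1))) by (simpl; ring).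
       rewrite exp_Ropp, exp_INR_mult, exp_ln by lra; reflexivity. }
  rewrite <- exp_plus; unfold Rpower.
  replace (exp (_ + _)) with (exp (ln (INR n + 1)) * exp (- x * ln (INR n + 1)))
    by (rewrite <- exp_plus; f_equal; ring).
  rewrite <- Rmult_assoc; apply Rmult_le_compat_r; [apply Rlt_le, exp_pos |].
  now apply pow_le_exp.
Qed.

Lemma zeta_term_summable_bound (j n : nat) (x : R) : 3 < x ->
  Rabs (zeta_term j n x) <= (INR j + 1) ^ j * / (INR n + 1) ^ 2.
Proof.
  intro Hx; apply Rle_trans with (1 := zeta_term_bound j n x).
  assert (Hn := pos_INR n); assert (Hl := ln_INR_succ_nonneg n).
  apply Rmult_le_compat_l; [apply pow_le; generalize (pos_INR j); lra |].
  rewrite <- (Rmult_1_r (/ (INR n + 1) ^ 2)) at 2; apply Rmult_le_compat_l.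
  - apply Rlt_le, Rinv_0_lt_compat; nra.
  - apply Rle_trans with (exp 0); [apply exp_monotone; nra | rewrite exp_0; lra].
Qed.

Lemma ex_zeta_series (j : nat) (x : R) : 3 < x -> ex_series (fun n => zeta_term j n x).
Proof.
  intro Hx; eapply ex_series_dominated.
  - intro n; now apply zeta_term_summable_bound.
  - apply (@ex_series_scal_l R_AbsRing R_NormedModule), ex_series_inverse_squares.
Qed.

Lemma is_derive_zeta_series (j : nat) (x : R) : 3 < x ->
  is_derive (zeta_series j) x (zeta_series (S j) x).
Proof.
  intro Hx; unfold zeta_series.
  apply (is_derive_Series (zeta_term j) (zeta_term (S j)) (zeta_term (S (S j)))
    (fun n => (INR (S (S j)) + 1) ^ S (S j) * / (INR n + 1) ^ 2) 3); trivial;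
    intros; try apply is_derive_zeta_term.
  - now apply zeta_term_summable_bound.
  - apply (@ex_series_scal_l R_AbsRing R_NormedModule), ex_series_inverse_squares.
  - now apply ex_zeta_series.
  - now apply ex_zeta_series.
Qed.

Lemma zeta_series_ge_1 (x : R) : 3 < x -> 1 <= zeta_series 0 x.
Proof.
  intro Hx; replace 1 with (zeta_term 0 0 x).
  - apply (Series_ge_first (fun n => zeta_term 0 n x)); [| now apply ex_zeta_series].
    intro n; unfold zeta_term; rewrite pow_O, Rmult_1_l; apply Rlt_le, exp_pos.
  - unfold zeta_term, Rpower; simpl INR; rewrite Rplus_0_l, ln_1, Rmult_0_r, exp_0.
    simpl; ring.
Qed.

(** The decay rate [2^(3 - x)] of the term [n = 2] of the Dirichlet series. *)
Definition decay (x : R) : R := exp ((3 - x) * ln 2).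

(** The logarithm kills the constant term [1] of the zeta series, so a
    differentiated series starts at [2^(-x)]. *)
Lemma zeta_series_decay (j : nat) :
  exists C, forall x, 3 < x -> Rabs (zeta_series (S j) x) <= C * decay x.
Proof.
  exists ((INR (S j) + 1) ^ S j * Series (fun n => / (INR n + 1) ^ 2)); intros x Hx.
  rewrite <- Series_scal_l, <- Series_scal_r; apply Rabs_Series_le.
  - intro n; rewrite Rmult_assoc.
    assert (Hc : 0 <= (INR (S j) + 1) ^ S j)
      by (apply pow_le; generalize (pos_INR (S j)); lra).
    destruct n as [| n].
    (* Index [0] is the integer [1], with [ln 1 = 0]. *)
    + replace (zeta_term (S j) 0 x) with 0.
      * rewrite Rabs_R0; apply Rmult_le_pos; [exact Hc |].
        apply Rmult_le_pos; [| apply Rlt_le, exp_pos].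
        simpl INR; apply Rlt_le, Rinv_0_lt_compat; nra.
      * unfold zeta_term; simpl INR; rewrite Rplus_0_l, ln_1; simpl; ring.
    + apply Rle_trans with (1 := zeta_term_bound _ _ _).
      apply Rmult_le_compat_l; [exact Hc |].
      assert (Hn := pos_INR n); rewrite S_INR.
      apply Rmult_le_compat_l; [apply Rlt_le, Rinv_0_lt_compat; nra |].
      apply exp_monotone.
      assert (ln 2 <= ln (INR n + 1 + 1)) by (apply ln_le; lra); nra.
  - apply ex_series_scal_r, (@ex_series_scal_l R_AbsRing R_NormedModule).
    apply ex_series_inverse_squares.
Qed.

Lemma decay_le_1 (x : R) : 3 < x -> decay x <= 1.
Proof.
  intro Hx; unfold decay; rewrite <- exp_0; apply exp_monotone.
  assert (0 < ln 2) by (rewrite <- ln_1; apply ln_increasing; lra); nra.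
Qed.

Lemma decay_beats_powers (m : nat) (C eps : R) : 0 < eps ->
  exists X, forall x, X < x -> C * x ^ m * decay x <= eps.
Proof.
  intro Heps; assert (Hl : 0 < ln 2) by (rewrite <- ln_1; apply ln_increasing; lra).
  set (K := (INR (S m) + 1) ^ S m * exp (3 * ln 2) / ln 2 ^ S m).
  exists (Rmax 1 (Rabs C * K / eps)); intros x Hx.
  assert (Hx1 := Rle_lt_trans _ _ _ (Rmax_l _ _) Hx).
  assert (Hx2 := Rle_lt_trans _ _ _ (Rmax_r _ _) Hx).
  apply Rlt_div_l in Hx2; [| exact Heps].
  assert (Hxm := pow_lt x m ltac:(lra)).
  assert (Hd : 0 < decay x) by apply exp_pos.
  assert (HK : x * (x ^ m * decay x) <= K).
  { assert (H := pow_le_exp (S m) (x * ln 2) ltac:(nra)).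
    rewrite Rpow_mult_distr in H.
    assert (Hlp := pow_lt _ (S m) Hl).
    unfold K; apply (proj1 (Rle_div_r _ _ _ Hlp)).
    replace (exp (3 * ln 2)) with (exp (x * ln 2) * decay x)
      by (unfold decay; rewrite <- exp_plus; f_equal; ring).
    replace (x * (x ^ m * decay x) * ln 2 ^ S m)
      with (x ^ S m * ln 2 ^ S m * decay x) by (simpl; ring).
    rewrite <- Rmult_assoc; apply Rmult_le_compat_r; lra. }
  apply Rle_trans with (Rabs C * (x ^ m * decay x)).
  - rewrite Rmult_assoc; apply Rmult_le_compat_r; [nra | apply Rle_abs].
  - apply Rmult_le_reg_l with x; [lra |].
    assert (Ha := Rabs_pos C); nra.
Qed.

(** * Functions whose derivatives decay, and the logarithm of zeta *)

(** Differentiability [n] times on [(a, oo)] with every derivative [O(w)].  The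
    recursion on [n] makes closure under products a plain induction that uses
    the product rule only, with no Leibniz formula. *)
Fixpoint dominated (a : R) (w : R -> R) (n : nat) (f : R -> R) : Prop :=
  (exists C, forall x, a < x -> Rabs (f x) <= C * w x) /\
  match n with
  | O => True
  | S m => exists g, (forall x, a < x -> is_derive f x (g x)) /\ dominated a w m g
  end.

Lemma dominated_pred a w n f : dominated a w (S n) f -> dominated a w n f.
Proof.
  revert f; induction n as [| n IH]; intros f [Hb (g & Hg & Hd)]; split; trivial.
  exists g; split; [exact Hg | now apply IH].
Qed.

Lemma dominated_opp a w n f : dominated a w n f -> dominated a w n (fun x => - f x).
Proof.
  revert f; induction n as [| n IH]; intros f [[C HC] Hd]; (split;
    [exists C; intros x Hx; rewrite Rabs_Ropp; now apply HC |]); trivial.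
  destruct Hd as (g & Hg & Hd); exists (fun x => - g x); split; [| now apply IH].
  intros x Hx; apply (@is_derive_opp R_AbsRing R_NormedModule); now apply Hg.
Qed.

Lemma dominated_plus a w n f g :
  dominated a w n f -> dominated a w n g -> dominated a w n (fun x => f x + g x).
Proof.
  revert f g; induction n as [| n IH]; intros f g [[C HC] Hf] [[D HD] Hg]; (split;
    [exists (C + D); intros x Hx; generalize (Rabs_triang (f x) (g x)) (HC x Hx) (HD x Hx);
     lra |]); trivial.
  destruct Hf as (f' & Hf & Hdf); destruct Hg as (g' & Hg & Hdg).
  exists (fun x => f' x + g' x); split; [| now apply IH].
  intros x Hx; apply (@is_derive_plus R_AbsRing R_NormedModule); auto.
Qed.

Lemma dominated_mult a w n f g :
  dominated a w n f -> dominated a (fun _ => 1) n g ->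
  dominated a w n (fun x => f x * g x).
Proof.
  revert f g; induction n as [| n IH]; intros f g Hf Hg;
    assert (Hf0 := Hf); assert (Hg0 := Hg);
    destruct Hf as [[C HC] Hf]; destruct Hg as [[D HD] Hg]; (split;
    [exists (C * D); intros x Hx; rewrite Rabs_mult;
     replace (C * D * w x) with ((C * w x) * (D * 1)) by ring;
     apply Rmult_le_compat; try apply Rabs_pos; auto |]); trivial.
  destruct Hf as (f' & Hf & Hdf); destruct Hg as (g' & Hg & Hdg).
  exists (fun x => f' x * g x + f x * g' x); split.
  - intros x Hx; apply (@is_derive_mult R_AbsRing); auto; intros; apply Rmult_comm.
  - apply dominated_plus; apply IH; trivial; now apply dominated_pred.
Qed.

Lemma dominated_bounded a w n f : (forall x, a < x -> 0 <= w x <= 1) ->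
  dominated a w n f -> dominated a (fun _ => 1) n f.
Proof.
  intro Hw; revert f; induction n as [| n IH]; intros f [[C HC] Hd]; (split;
    [exists (Rabs C); intros x Hx; apply Rle_trans with (1 := HC x Hx);
     generalize (Hw x Hx) (Rle_abs C) (Rabs_pos C); nra |]); trivial.
  destruct Hd as (g & Hg & Hd); exists g; split; [exact Hg | now apply IH].
Qed.

(** The derivative [- g (1/f) (1/f)] of [1/f] is a product that involves [1/f]
    with one derivative fewer, so induction on the order applies. *)
Lemma dominated_inverse a n f g :
  (forall x, a < x -> 1 <= f x) ->
  (forall x, a < x -> is_derive f x (g x)) ->
  (forall m, dominated a (fun _ => 1) m g) ->
  dominated a (fun _ => 1) n (fun x => / f x).
Proof.
  intros Hf Hfg Hg.
  assert (Hb : exists C, forall x, a < x -> Rabs (/ f x) <= C * 1).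
  { exists 1; intros x Hx; specialize (Hf x Hx).
    rewrite Rmult_1_r, Rabs_pos_eq by (apply Rlt_le, Rinv_0_lt_compat; lra).
    rewrite <- Rinv_1; apply Rinv_le_contravar; lra. }
  induction n as [| n IH]; split; trivial.
  exists (fun x => - (g x * / f x * / f x)); split.
  - intros x Hx; specialize (Hf x Hx).
    replace (- (g x * / f x * / f x)) with (- g x / (f x) ^ 2) by (field; lra).
    apply is_derive_inv; [now apply Hfg | lra].
  - apply dominated_opp, dominated_mult; [apply dominated_mult |]; trivial.
Qed.

(** A finite tower of successive derivatives.  Working with such towers keeps
    [Derive_n], which is awkward on half-lines, out of the computations. *)
Definition derivative_chain (a : R) (n : nat) (D : nat -> R -> R) : Prop :=
  forall j x, (j < n)%nat -> a < x -> is_derive (D j) x (D (S j) x).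

Lemma dominated_chain a w n f : dominated a w n f ->
  exists D, D 0%nat = f /\ derivative_chain a n D /\
    exists C, forall x, a < x -> Rabs (D n x) <= C * w x.
Proof.
  revert f; induction n as [| n IH]; intros f [Hb Hd].
  - exists (fun _ => f); split; [reflexivity | split; [| exact Hb]].
    intros j x Hj; lia.
  - destruct Hd as (g & Hg & Hd); destruct (IH g Hd) as (D & E & HD & HC).
    exists (fun j => match j with O => f | S i => D i end).
    split; [reflexivity | split; [| exact HC]].
    intros [| j] x Hj Hx; [rewrite E; now apply Hg | apply HD; [lia | exact Hx]].
Qed.

Lemma dominated_zeta_series (n j : nat) : dominated 3 decay n (zeta_series (S j)).
Proof.
  revert j; induction n as [| n IH]; intro j; (split; [apply zeta_series_decay |]); trivial.
  exists (zeta_series (S (S j))); split; [| apply IH].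
  intros x Hx; now apply is_derive_zeta_series.
Qed.

(** The first derivative [zeta' / zeta] is a decaying function times a function
    with bounded derivatives. *)
Lemma log_zeta_chain (n : nat) :
  exists E, (forall x, E 0%nat x = ln (zeta x)) /\ derivative_chain 3 (S n) E /\
    exists C, forall x, 3 < x -> Rabs (E (S n) x) <= C * decay x.
Proof.
  assert (Hq : dominated 3 decay n (fun x => zeta_series 1 x * / zeta_series 0 x)).
  { apply dominated_mult; [apply dominated_zeta_series |].
    apply dominated_inverse with (zeta_series 1).
    - exact zeta_series_ge_1.
    - intros x Hx; now apply is_derive_zeta_series.
    - intro m; apply dominated_bounded with decay; [| apply dominated_zeta_series].
      intros x Hx; split; [apply Rlt_le, exp_pos | now apply decay_le_1]. }
  destruct (dominated_chain _ _ _ _ Hq) as (D & E0 & HD & HC).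
  exists (fun j => match j with O => fun x => ln (zeta x) | S i => D i end).
  split; [reflexivity | split; [| exact HC]].
  intros [| j] x Hj Hx; [| apply HD; [lia | exact Hx]].
  rewrite E0; apply is_derive_ext with (fun t => ln (zeta_series 0 t)).
  - intro t; now rewrite zeta_series_0.
  - assert (Hz := zeta_series_ge_1 x Hx).
    apply (is_derive_comp ln (zeta_series 0)).
    + apply is_derive_ln; lra.
    + now apply is_derive_zeta_series.
Qed.

(** * The derivatives of a quotient by x *)

Lemma Derive_n_of_chain (f : R -> R) (D : nat -> R -> R) (a : R) (n : nat) :
  derivative_chain a n D -> (forall x, a < x -> f x = D 0%nat x) ->
  forall j, (j <= n)%nat -> forall x, a < x ->
    ex_derive_n f j x /\ Derive_n f j x = D j x.
Proof.
  intros HD Hf; induction j as [| j IH]; intros Hj x Hx; [now split; [| apply Hf] |].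
  assert (Hder : is_derive (Derive_n f j) x (D (S j) x)).
  { apply is_derive_ext_loc with (D j); [| apply HD; [lia | exact Hx]].
    assert (Hd : 0 < x - a) by lra.
    exists (mkposreal _ Hd); intros t Ht; symmetry; apply IH; [lia |].
    change (Rabs (t - x) < x - a) in Ht; apply Rabs_def2 in Ht; lra. }
  split; [eexists; exact Hder | now apply is_derive_unique].
Qed.

(** The Taylor polynomial of order [j] of [D 0] based at [x], evaluated at [0];
    the base point is the variable. *)
Fixpoint taylor_at_zero (D : nat -> R -> R) (j : nat) (x : R) : R :=
  match j with
  | O => D 0%nat x
  | S i => taylor_at_zero D i x + (- x) ^ S i / INR (fact (S i)) * D (S i) x
  end.

(** Differentiating in the base point telescopes: only the top-order term
    survives. *)
Lemma is_derive_taylor_at_zero (D : nat -> R -> R) (a : R) (n : nat) :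
  derivative_chain a n D ->
  forall j x, (j < n)%nat -> a < x ->
    is_derive (taylor_at_zero D j) x ((- x) ^ j / INR (fact j) * D (S j) x).
Proof.
  intros HD; induction j as [| j IH]; intros x Hj Hx.
  - replace ((- x) ^ 0 / INR (fact 0) * D 1%nat x) with (D 1%nat x) by (simpl; field).
    now apply HD.
  - assert (Hf := INR_fact_neq_0 j); assert (Hj1 := pos_INR j).
    assert (Efact : INR (fact (S j)) = (INR j + 1) * INR (fact j))
      by (rewrite <- S_INR, <- mult_INR; reflexivity).
    assert (Hm : is_derive (fun t => (- t) ^ S j / INR (fact (S j))) x
                   (- ((- x) ^ j / INR (fact j)))).
    { replace (- ((- x) ^ j / INR (fact j)))
        with (- INR (S j) * (- x) ^ j / INR (fact (S j)))
        by (rewrite Efact, S_INR; field; split; [exact Hf | lra]).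
      generalize (INR (fact (S j))); intro c.
      auto_derive; [trivial | change (- (1) * (INR (S j) * (- x) ^ j) * / c
                                  = - INR (S j) * (- x) ^ j / c); unfold Rdiv; ring]. }
    assert (Hprod := is_derive_mult _ _ _ _ _ Hm (HD (S j) x Hj Hx) Rmult_comm).
    assert (Hsum := is_derive_plus _ _ _ _ _ (IH x ltac:(lia) Hx) Hprod).
    replace ((- x) ^ S j / INR (fact (S j)) * D (S (S j)) x) with
      ((- x) ^ j / INR (fact j) * D (S j) x +
       (- ((- x) ^ j / INR (fact j)) * D (S j) x
        + (- x) ^ S j / INR (fact (S j)) * D (S (S j)) x)) by ring.
    exact Hsum.
Qed.

(** This is the Leibniz formula for the derivatives of [D 0 x / x], collected
    so that all the terms other than the sign, the factorial and the power of
    [x] form a Taylor polynomial. *)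
Lemma is_derive_taylor_quotient (D : nat -> R -> R) (a : R) (n : nat) :
  0 <= a -> derivative_chain a n D ->
  derivative_chain a n
    (fun j x => (-1) ^ j * INR (fact j) * (taylor_at_zero D j x * / x ^ S j)).
Proof.
  intros Ha HD j x Hj Hx.
  assert (Hh := is_derive_taylor_at_zero D a n HD j x Hj Hx).
  assert (Hp : is_derive (fun t => / t ^ S j) x (- INR (S j) * / x ^ S (S j))).
  { assert (H := is_derive_inv_pow 0 (S j) x ltac:(lra)); rewrite Rplus_0_r in H.
    apply is_derive_ext with (2 := H); intro t; now rewrite Rplus_0_r. }
  assert (Hprod := is_derive_scal _ _ ((-1) ^ j * INR (fact j)) _
                     (is_derive_mult _ _ _ _ _ Hh Hp Rmult_comm)).
  replace ((-1) ^ S j * INR (fact (S j)) * (taylor_at_zero D (S j) x * / x ^ S (S j)))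
    with ((-1) ^ j * INR (fact j) *
          ((- x) ^ j / INR (fact j) * D (S j) x * / x ^ S j
           + taylor_at_zero D j x * (- INR (S j) * / x ^ S (S j)))).
  - exact Hprod.
  - change (taylor_at_zero D (S j) x) with
      (taylor_at_zero D j x + (- x) ^ S j / INR (fact (S j)) * D (S j) x).
    replace (- x) with (-1 * x) by ring; rewrite !Rpow_mult_distr.
    assert (Hf := INR_fact_neq_0 j); assert (Hj1 := pos_INR j).
    replace (INR (fact (S j))) with ((INR j + 1) * INR (fact j))
      by (rewrite <- S_INR, <- mult_INR; reflexivity).
    rewrite S_INR; assert (Hxj := pow_nonzero x j ltac:(lra)).
    simpl pow; field; repeat split; lra.
Qed.

(** The function [h + c ln] is nonincreasing and [ln] is unbounded, so [h] tends
    to minus infinity. *)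
Lemma eventually_negative (h dh : R -> R) (c a : R) : 0 < c -> 0 < a ->
  (forall x, a < x -> is_derive h x (dh x)) ->
  (forall x, a < x -> dh x <= - (c / x)) ->
  exists X, forall x, X < x -> h x < 0.
Proof.
  intros Hc Ha Hh Hdh; set (b := a + 1).
  set (A := h b + c * ln b).
  exists (Rmax b (exp (A / c))); intros x Hx.
  assert (Hx1 := Rle_lt_trans _ _ _ (Rmax_l _ _) Hx).
  assert (Hx2 := Rle_lt_trans _ _ _ (Rmax_r _ _) Hx).
  assert (Hb : a < b) by (unfold b; lra).
  assert (HD : forall t, b <= t -> is_derive (fun t => h t + c * ln t) t (dh t + c * / t)).
  { intros t Ht; apply (@is_derive_plus R_AbsRing R_NormedModule); [apply Hh; lra |].
    apply is_derive_scal, is_derive_ln; lra. }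
  destruct (MVT_gen (fun t => h t + c * ln t) b x (fun t => dh t + c * / t))
    as (d & Hd & E).
  { intros t Ht; rewrite Rmin_left in Ht by lra; apply HD; lra. }
  { intros t Ht; rewrite Rmin_left in Ht by lra.
    eapply is_derive_continuity_pt, HD; lra. }
  rewrite Rmin_left, Rmax_right in Hd by lra.
  assert (Hdd := Hdh d ltac:(lra)).
  assert (Hneg : (dh d + c * / d) * (x - b) <= 0) by (unfold Rdiv in Hdd; nra).
  assert (Hln : A / c < ln x).
  { rewrite <- (ln_exp (A / c)); apply ln_increasing; [apply exp_pos | exact Hx2]. }
  apply Rlt_div_l in Hln; [| exact Hc]; unfold A in Hln; lra.
Qed.

(** * The sign of the derivatives of log theta *)

Lemma log_theta_eq (x : R) : 3 < x ->
  log_theta x = (ln 2 + ln (zeta x) + ln (Gamma (x + 1))) * / x.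
Proof.
  intro Hx; assert (Hz := zeta_series_ge_1 x Hx); rewrite zeta_series_0 in Hz.
  assert (HG := Gamma_pos (x + 1) ltac:(lra)).
  unfold log_theta, theta; rewrite ln_Rpower, !ln_mult by lra.
  unfold Rdiv; ring.
Qed.

(** The numerator of [log_theta] is the log Gamma series plus [ln zeta] plus a
    constant.  At order [i + 2] the series contributes at least
    [1 / (2^(i+2) x)] to the quantity below, with a minus sign, while zeta
    contributes [x^(i+1) O(2^(-x))], eventually at most half of this. *)
Lemma log_numerator_chain (i : nat) :
  exists F a, 3 <= a /\
    (forall x, a < x -> F 0%nat x = ln 2 + ln (zeta x) + ln (Gamma (x + 1))) /\
    derivative_chain a (S (S i)) F /\
    exists c, 0 < c /\ forall x, a < x ->
      (- x) ^ S i / INR (fact (S i)) * F (S (S i)) x <= - (c / x).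
Proof.
  destruct (log_zeta_chain (S i)) as (E & E0 & HE & C & HC).
  destruct log_Gamma_series_representation as (c0 & HG).
  (* Half of the coefficient of [1 / x] in [x^(i+1) / (2 x)^(i+2)]. *)
  set (c := / 2 ^ S (S (S i))).
  assert (Hc : 0 < c) by (apply Rinv_0_lt_compat, pow_lt; lra).
  assert (Hf := INR_fact_lt_0 (S i)).
  destruct (decay_beats_powers (S (S i)) (C / INR (fact (S i))) c Hc) as (X & HX).
  exists (fun j x => E j x + log_gamma_series j x
                     + match j with O => ln 2 + c0 | S _ => 0 end), (Rmax 3 X).
  assert (H3 := Rmax_l 3 X); assert (HmX := Rmax_r 3 X).
  split; [exact H3 | split; [| split]].
  - intros x Hx; rewrite E0, HG by lra; ring.
  - intros j x Hj Hx.
    replace (E (S j) x + log_gamma_series (S j) x + 0)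
      with (E (S j) x + log_gamma_series (S j) x + zero) by reflexivity.
    apply (@is_derive_plus R_AbsRing R_NormedModule).
    + apply (@is_derive_plus R_AbsRing R_NormedModule).
      * apply HE; [exact Hj | lra].
      * apply is_derive_log_gamma_series; lra.
    + apply (@is_derive_const R_AbsRing R_NormedModule).
  - exists c; split; [exact Hc |]; intros x Hx.
    assert (HL := log_gamma_series_derivative_lower_bound i x ltac:(lra)).
    assert (HEx := HC x ltac:(lra)); assert (HXx := HX x ltac:(lra)).
    set (L := log_gamma_series (S (S i)) x) in *; set (e := E (S (S i)) x) in *.
    assert (Hxp := pow_lt x (S i) ltac:(lra)).
    assert (Hx2 : 2 * c / x <= x ^ S i / (x + 1) ^ S (S i)).
    { replace (2 * c / x) with (x ^ S i / (2 * x) ^ S (S i)).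
      - apply Rmult_le_compat_l; [lra |].
        apply Rinv_le_contravar; [apply pow_lt; lra | apply pow_incr; lra].
      - unfold c; rewrite Rpow_mult_distr; simpl pow.
        assert (H2 := pow_nonzero 2 i ltac:(lra)).
        assert (Hxi := pow_nonzero x i ltac:(lra)).
        field; repeat split; lra. }
    assert (Hgam : 2 * c / x <= x ^ S i / INR (fact (S i)) * ((-1) ^ i * L)).
    { apply Rle_trans with (1 := Hx2).
      replace (x ^ S i / (x + 1) ^ S (S i)) with
        (x ^ S i / INR (fact (S i)) * (INR (fact (S i)) / (x + 1) ^ S (S i))).
      - apply Rmult_le_compat_l; [| exact HL].
        apply Rlt_le, Rdiv_lt_0_compat; assumption.
      - assert (H1 := pow_nonzero (x + 1) (S (S i)) ltac:(lra)); field; split; lra. }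
    assert (Hzet : x ^ S i / INR (fact (S i)) * Rabs e <= c / x).
    { apply Rle_trans with (x ^ S i / INR (fact (S i)) * (C * decay x)).
      - apply Rmult_le_compat_l; [| exact HEx].
        apply Rlt_le, Rdiv_lt_0_compat; assumption.
      - apply (proj1 (Rle_div_r _ _ _ (ltac:(lra) : x > 0))).
        replace (x ^ S i / INR (fact (S i)) * (C * decay x) * x)
          with (C / INR (fact (S i)) * x ^ S (S i) * decay x)
          by (simpl pow; field; lra).
        exact HXx. }
    assert (Habs : - Rabs e <= (-1) ^ i * e).
    { assert (H := Rle_abs (- ((-1) ^ i * e))).
      rewrite Rabs_Ropp, Rabs_mult, pow_1_abs in H; lra. }
    assert (Hq : 0 < x ^ S i / INR (fact (S i))) by now apply Rdiv_lt_0_compat.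
    replace (- x) with (-1 * x) by ring; rewrite Rpow_mult_distr.
    replace ((-1) ^ S i) with (- (-1) ^ i) by (simpl; ring).
    replace (- (-1) ^ i * x ^ S i / INR (fact (S i)) * (e + L + 0))
      with (- (x ^ S i / INR (fact (S i)) * ((-1) ^ i * L))
            - x ^ S i / INR (fact (S i)) * ((-1) ^ i * e)) by (field; lra).
    assert (Hm := Rmult_le_compat_l _ _ _ (Rlt_le _ _ Hq) Habs).
    unfold Rdiv in *; lra.
Qed.

Theorem theorem3p1 (k : nat) (hk : (2 <= k)%nat) :
  exists X : R, forall x : R, 1 < x -> X < x ->
    k_times_derivable log_theta k x /\
    (-1) ^ k * Derive_n log_theta k x < 0.
Proof.
  destruct k as [| i]; [lia |].
  destruct (log_numerator_chain i) as (F & a & Ha & F0 & HF & c & Hc & Hdec).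
  destruct (eventually_negative (taylor_at_zero F (S i))
    (fun x => (- x) ^ S i / INR (fact (S i)) * F (S (S i)) x) c a Hc ltac:(lra))
    as (X & HX).
  { intros x Hx; apply is_derive_taylor_at_zero with a (S (S i)); trivial; lia. }
  { exact Hdec. }
  assert (HT := is_derive_taylor_quotient F a (S (S i)) ltac:(lra) HF).
  assert (HD := Derive_n_of_chain log_theta _ a (S (S i)) HT).
  assert (Hth : forall x, a < x -> log_theta x =
            (-1) ^ 0 * INR (fact 0) * (taylor_at_zero F 0 x * / x ^ 1)).
  { intros x Hx; rewrite log_theta_eq by lra; simpl; rewrite F0 by exact Hx; field; lra. }
  specialize (HD Hth).
  exists (Rmax a X); intros x _ Hx.
  assert (Hxa := Rle_lt_trans _ _ _ (Rmax_l _ _) Hx).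
  assert (HxX := Rle_lt_trans _ _ _ (Rmax_r _ _) Hx).
  split.
  - intros j Hj; apply (HD j ltac:(lia) x Hxa).
  - destruct (HD (S i) ltac:(lia) x Hxa) as [_ ->].
    assert (Hsq : (-1) ^ S i * (-1) ^ S i = 1).
    { rewrite <- Rpow_mult_distr; replace (-1 * -1) with 1 by ring; apply pow1. }
    rewrite <- !Rmult_assoc, Hsq, Rmult_1_l.
    assert (Hf := INR_fact_lt_0 (S i)); assert (Hh := HX x HxX).
    assert (Hp : 0 < / x ^ S (S i)) by (apply Rinv_0_lt_compat, pow_lt; lra).
    apply Rmult_lt_reg_r with (x ^ S (S i)); [apply pow_lt; lra |].
    rewrite Rmult_assoc, Rinv_l by (apply pow_nonzero; lra); nra.
Qed.
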